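(* $$\sum_{n=0}^{\infty} (M_e(5n+4) - M_o(5n+4))q^n = \frac{5(q;q^2)_{\infty}^2(q^5;q^5)_{\infty}(q^{10};q^{10})_{\infty}^2}{(q^2;q^2)_{\infty}^2}.$$
   Context: For $|q|<1$ write $(z;q)_\infty=\prod_{j\geq 0}(1-zq^j)$. $M_e(n)$ (resp. $M_o(n)$) denotes the number of partitions of $n$ with even (resp. odd) Andrews–Garvan crank, where the crank counts $M(m,n)$ are defined by $\sum_{m,n}M(m,n)a^mq^n=\frac{(q;q)_\infty}{(aq;q)_\infty(q/a;q)_\infty}$; equivalently $\sum_{n\geq 0}(M_e(n)-M_o(n))q^n=\frac{(q;q)_\infty}{(-q;q)_\infty^2}$. *)

(* Defs.v *)
(* Formal power series in q with integer coefficients are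
   handled through truncations: an infinite product is represented by the
   family of finite products of its first N+1 factors (as polynomials in
   {poly int}); for every such product below, the coefficient of q^n is
   already stable once N >= n. *)
From HB Require Import structures.
From mathcomp Require Import all_boot all_order all_algebra.
Set Implicit Arguments. Unset Strict Implicit. Unset Printing Implicit Defensive.
Import Order.TTheory GRing.Theory Num.Theory.
Local Open Scope ring_scope.

Definition qpoch (c : int) (a b N : nat) : {poly int} :=
  \prod_(j < N.+1) (1 - c *: 'X^(a + b * j)).

(* 1 / (c q^a ; q^b)_oo truncated: each factor 1/(1 - c q^(a+bj)) is replaced
   by its geometric series truncated at exponent k <= N. *)
Definition qpochinv (c : int) (a b N : nat) : {poly int} :=
  \prod_(j < N.+1) \sum_(k < N.+1) (c ^+ k) *: 'X^((a + b * j) * k).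

Definition fcoef (F : nat -> {poly int}) (n : nat) : int := (F n)`_n.

(* Generating function  sum_n (M_e(n) - M_o(n)) q^n = (q;q)_oo / (-q;q)_oo^2 *)
Definition crank_eo_gf (N : nat) : {poly int} :=
  qpoch 1 1 1 N * (qpochinv (-1) 1 1 N) ^+ 2.

Definition Me_minus_Mo (n : nat) : int := fcoef crank_eo_gf n.

Definition rhs_gf (N : nat) : {poly int} :=
  5%:R * (qpoch 1 1 2 N) ^+ 2 * qpoch 1 5 5 N * (qpoch 1 10 10 N) ^+ 2
    * (qpochinv 1 2 2 N) ^+ 2.

(* Main.v *)
Require Import Defs.
From mathcomp Require Import all_boot all_order all_algebra.
From HB Require Import structures.
From mathcomp Require Import qpoly.
From mathcomp Require Import zify ring.

(** Write f_k = (q^k; q^k)_oo and let chi be the quadratic character mod 5. The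
    generating function is f_1^3 / f_2^2, and the key identity is
      q f_1^3 f_5 f_10^2 / f_2^2 = sum_(n > 0) chi(n) q^n / (1 + q^n)^2.
    Expanding the right side as sum_(n, d > 0) chi(n) (-1)^(d-1) d q^(nd), the
    coefficient of q^(5k) is 5 times that of q^k, since chi(n) = 0 when 5 | n.
    As f_5 f_10^2 is a series in q^5, comparing the exponents divisible by 5 on
    both sides gives the theorem.

    The key identity is the difference formula for the Weierstrass function in
    base q^5 at the points -q and -q^2. Put theta_a = sum_m q^(g_a(m)) with
    g_a(m) = 5 m (m - 1) / 2 + a m, for a = 1, 2. By the Jacobi triple product,
    a second logarithmic derivative turns the Lambert series E_a of residues
    +-a into 2 theta_a^2 E_a = sum_(m, n) (m - n)^2 q^(g_a(m) + g_a(n)).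
    Splitting Z^2 by the parity of m - n writes this sum and theta_a^2 in terms
    of the same two series A_a and B_a, so that E_1 - E_2 reduces to
    A_2 B_1 - A_1 B_2, which the same splitting shows to be q f_1 f_5, and to a
    combination of null values, which it shows to be 2 (f_5^3)^2.

    Power series are handled as elements of rings in which q is nilpotent, such
    as {poly int} modulo 'X^M; all sums and products are then finite. *)

Set Implicit Arguments. Unset Strict Implicit. Unset Printing Implicit Defensive.
Import Order.TTheory GRing.Theory Num.Theory.
Local Open Scope ring_scope.

(** * The finite Jacobi triple product *)

(** m (m - 1) / 2 as a natural number, usable as an exponent for either sign of m; [Negz n] stands
    for -(n + 1). *)
Definition tri (m : int) : nat :=
  match m with Posz n => 'C(n, 2) | Negz n => 'C(n.+2, 2) end.

Lemma mul2_tri (m : int) : 2 * (tri m)%:Z = m * (m - 1).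
Proof.
have mul2_bin2 n : (2 * 'C(n, 2))%:Z = n%:Z * (n%:Z - 1).
  by elim: n => [|n IH] //; rewrite binS bin1; lia.
by case: m => n; rewrite /tri; [have := mul2_bin2 n | have := mul2_bin2 n.+2]; lia.
Qed.

Fixpoint qbin (R : comNzRingType) (p : R) (n k : nat) : R :=
  match n, k with
  | _, 0 => 1
  | 0, _.+1 => 0
  | n.+1, k'.+1 => qbin p n k' + p ^+ k'.+1 * qbin p n k'.+1
  end.

Section QBinomial.
Variable R : comNzRingType.
Implicit Types p x y z : R.

Lemma qbin0 p n : qbin p n 0 = 1. Proof. by case: n. Qed.

Lemma qbin_small p n k : (n < k)%N -> qbin p n k = 0.
Proof.
elim: n k => [|n IH] [|k] //= lt_nk.
by rewrite !IH ?mulr0 ?addr0 //; lia.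
Qed.

Definition poch p n : R := \prod_(j < n) (1 - p ^+ j.+1).

Lemma pochS p n : poch p n.+1 = poch p n * (1 - p ^+ n.+1).
Proof. by rewrite /poch big_ord_recr. Qed.

Lemma qbin_poch p n k : (k <= n)%N ->
  qbin p n k * (poch p k * poch p (n - k)) = poch p n.
Proof.
elim: n k => [|n IH] [|k] // le_kn.
- by rewrite /poch !big_ord0 !mul1r.
- by rewrite qbin0 /poch big_ord0 !mul1r subn0.
rewrite /= subSS; have [lt_kn|le_nk] := ltnP k n; last first.
  have -> : k = n by lia.
  rewrite (@qbin_small _ n n.+1) // mulr0 addr0 !pochS subnn.
  rewrite -{2}(IH n (leqnn n)) subnn; ring.
have H1 := IH _ lt_kn; have H2 := IH k (ltnW lt_kn).
have E : (n - k = (n - k.+1).+1)%N by lia.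
(* The two Pascal terms add up by (1 - p^(k+1)) + p^(k+1) (1 - p^(n-k)) = 1 - p^(n+1). *)
rewrite mulrDl !pochS.
have -> : qbin p n k * (poch p k * (1 - p ^+ k.+1) * poch p (n - k)) =
  (1 - p ^+ k.+1) * poch p n by rewrite -H2; ring.
have -> : p ^+ k.+1 * qbin p n k.+1 *
   (poch p k * (1 - p ^+ k.+1) * poch p (n - k)) =
  p ^+ k.+1 * (1 - p ^+ (n - k)) * poch p n.
  by rewrite -H1 E !pochS; ring.
rewrite mulrBr mulr1 -exprD; have -> : (k.+1 + (n - k) = n.+1)%N by lia.
ring.
Qed.

(* Exponents stay natural by writing Ramanujan's theta function
   f(-zx, -y/z), with z^b cleared, in place of a Laurent polynomial. *)
Definition jtp_prod x y z a b : R :=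
  (\prod_(j < a) (1 - z * x * (x * y) ^+ j)) *
  \prod_(j < b) (z - y * (x * y) ^+ j).

(** With m = k - b this is, up to the factor [qbin], the term (-1)^m x^(m(m+1)/2) y^(m(m-1)/2) of
    the theta series. *)
Definition jtp_coef x y a b (k : nat) : R :=
  (-1) ^+ (k + b) * qbin (x * y) (a + b) k
  * (x ^+ tri (k%:Z - b%:Z + 1) * y ^+ tri (k%:Z - b%:Z)).

(** Each new linear factor of the product acts on the summands by a two-term recurrence; both
    inductions for the triple product go through this form. *)
Lemma sum_two_term (A B : R) (u v : nat -> R) n :
  u n = 0 -> v 0 = A * u 0 -> (forall k, v k.+1 = A * u k.+1 + B * u k) ->
  \sum_(k < n.+1) v k = (A + B) * \sum_(k < n) u k.
Proof.
move=> un0 v0 vS; rewrite big_ord_recl v0.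
under eq_bigr => i _ do rewrite lift0 vS.
rewrite big_split /= -!mulr_sumr mulrDl addrA -mulrDr; congr (_ * _ + _).
have <- : \sum_(k < n.+1) u k = u 0 + \sum_(k < n) u k.+1.
  by rewrite big_ord_recl; congr (_ + _); apply: eq_bigr => i _; rewrite lift0.
by rewrite big_ord_recr /= un0 addr0.
Qed.

Lemma finite_jtp0 x y z a :
  jtp_prod x y z a 0 = \sum_(k < a.+1) jtp_coef x y a 0 k * z ^+ k.
Proof.
rewrite /jtp_prod big_ord0 mulr1.
elim: a z => [|a IH] z.
  rewrite big_ord0 big_ord_recl big_ord0 /jtp_coef /= /tri /=.
  by rewrite ?expr0 ?mulr1 ?addr0.
rewrite big_ord_recl expr0 mulr1.
(* The remaining factors form the product for [a] at z x y, which is why z varies in the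
   induction. *)
under eq_bigr => i _.
  have -> : z * x * (x * y) ^+ lift ord0 i = z * (x * y) * x * (x * y) ^+ i.
    by rewrite /= /bump /= exprS; ring.
  over.
rewrite IH; symmetry.
apply: (@sum_two_term 1 (- (z * x)) (fun k => jtp_coef x y a 0 k * (z * (x * y)) ^+ k)
   (fun k => jtp_coef x y a.+1 0 k * z ^+ k)) => /=.
- by rewrite /jtp_coef qbin_small ?addn0 // mulr0 !mul0r.
- by rewrite /jtp_coef !qbin0 mul1r.
move=> k; rewrite /jtp_coef.
have -> : tri (k.+1%:Z - 0%:Z + 1) = (tri (k%:Z - 0%:Z + 1) + k.+1)%N.
  have := mul2_tri (k.+1%:Z - 0%:Z + 1); have := mul2_tri (k%:Z - 0%:Z + 1); lia.
have -> : tri (k.+1%:Z - 0%:Z) = (tri (k%:Z - 0%:Z) + k)%N.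
  have := mul2_tri (k.+1%:Z - 0%:Z); have := mul2_tri (k%:Z - 0%:Z); lia.
by rewrite !addn0 /= !exprD !exprMn !exprS; ring.
Qed.

Lemma finite_jtp x y z a b :
  jtp_prod x y z a b = \sum_(k < (a + b).+1) jtp_coef x y a b k * z ^+ k.
Proof.
elim: b => [|b IH]; first by rewrite addn0 finite_jtp0.
have -> : jtp_prod x y z a b.+1 = (- (y * (x * y) ^+ b) + z) * jtp_prod x y z a b.
  by rewrite /jtp_prod big_ord_recr /=; ring.
rewrite IH addnS; symmetry.
apply: (@sum_two_term (- (y * (x * y) ^+ b)) z (fun k => jtp_coef x y a b k * z ^+ k)
   (fun k => jtp_coef x y a b.+1 k * z ^+ k)) => /=.
- by rewrite /jtp_coef qbin_small // mulr0 !mul0r.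
- rewrite /jtp_coef !qbin0 !add0n.
  have -> : (tri (0%:Z - b.+1%:Z + 1) = tri (0%:Z - b%:Z + 1) + b)%N.
    have := mul2_tri (0%:Z - b.+1%:Z + 1); have := mul2_tri (0%:Z - b%:Z + 1); lia.
  have -> : (tri (0%:Z - b.+1%:Z) = tri (0%:Z - b%:Z) + b.+1)%N.
    have := mul2_tri (0%:Z - b.+1%:Z); have := mul2_tri (0%:Z - b%:Z); lia.
  rewrite !exprD !exprMn !exprS; ring.
move=> k; rewrite /jtp_coef (addnS a) (addnS k.+1) /=.
have -> : k.+1%:Z - b.+1%:Z = k%:Z - b%:Z by lia.
have -> : y * (x * y) ^+ b = x ^+ b * y ^+ b.+1 by rewrite exprMn exprS; ring.
have H1 : (tri (k.+1%:Z - b%:Z + 1) + b = tri (k%:Z - b%:Z + 1) + k.+1)%N.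
  have := mul2_tri (k.+1%:Z - b%:Z + 1); have := mul2_tri (k%:Z - b%:Z + 1); lia.
have H2 : (tri (k.+1%:Z - b%:Z) + b.+1 = tri (k%:Z - b%:Z) + k.+1)%N.
  have := mul2_tri (k.+1%:Z - b%:Z); have := mul2_tri (k%:Z - b%:Z); lia.
have -> : - (x ^+ b * y ^+ b.+1) *
    ((-1) ^+ (k.+1 + b) * qbin (x * y) (a + b) k.+1 *
     (x ^+ tri (k.+1%:Z - b%:Z + 1) * y ^+ tri (k.+1%:Z - b%:Z)) * z ^+ k.+1) =
  - ((-1) ^+ (k.+1 + b) * qbin (x * y) (a + b) k.+1 *
  (x ^+ (tri (k.+1%:Z - b%:Z + 1) + b) * y ^+ (tri (k.+1%:Z - b%:Z) + b.+1)) *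
   z ^+ k.+1).
  rewrite (exprD x) (exprD y); ring.
by rewrite H1 H2 addSn !exprD exprMn !exprS ?exprD; ring.
Qed.

End QBinomial.

(** * Bilateral sums *)

Definition box (K : nat) : seq int := [seq i%:Z - K%:Z | i <- index_iota 0 (2 * K).+1].

Lemma mem_box K (m : int) : (m \in box K) = (`|m| <= K%:Z).
Proof.
apply/mapP/idP => [[i] | le_m].
  by rewrite mem_index_iota => /andP [_ lt_i] ->; lia.
exists `|(m + K%:Z)%R|%N; last by lia.
by rewrite mem_index_iota; lia.
Qed.

Lemma box_uniq K : uniq (box K).
Proof. by rewrite map_inj_uniq ?iota_uniq // => i j; lia. Qed.

Section BilateralSums.
Variable V : nmodType.

Lemma eq_sum_support (T : choiceType) (F : T -> V) (r s : seq T) :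
  uniq r -> uniq s -> (forall x, F x != 0 -> (x \in r) = (x \in s)) ->
  \sum_(x <- r) F x = \sum_(x <- s) F x.
Proof.
move=> Ur Us rs.
have nz t : \sum_(x <- t) F x = \sum_(x <- [seq x <- t | F x != 0]) F x.
  by rewrite big_filter [RHS]big_mkcond; apply: eq_bigr => x _; case: eqP.
rewrite nz (nz s); apply: perm_big; apply: uniq_perm; rewrite ?filter_uniq //.
by move=> x; rewrite !mem_filter; case: eqP => //= /eqP; apply: rs.
Qed.

Definition zsum K (F : int -> V) := \sum_(m <- box K) F m.

Definition supported K (F : int -> V) := forall m, K%:Z < `|m| -> F m = 0.

Lemma zsum_ord K F : zsum K F = \sum_(i < (2 * K).+1) F (i%:Z - K%:Z).
Proof. by rewrite /zsum /box big_map big_mkord. Qed.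

Lemma eq_zsum K F G : F =1 G -> zsum K F = zsum K G.
Proof. by move=> FG; apply: eq_bigr => m _. Qed.

(** A bijection of Z need not preserve the box; it is enough that no nonzero term lies outside it
    before or after the substitution. *)
Lemma zsum_reindex K (h k : int -> int) F : cancel h k -> cancel k h ->
  supported K F -> supported K (F \o h) -> zsum K F = zsum K (F \o h).
Proof.
move=> hK kK sF sFh; have h_inj := can_inj hK; rewrite /zsum -[RHS](big_map h xpredT).
apply: eq_sum_support; [exact: box_uniq | by rewrite map_inj_uniq ?box_uniq |].
move=> x Fx; have -> : x \in box K.
  by rewrite mem_box leNgt; apply: contraNN Fx => /sF ->.
symmetry; apply/mapP; exists (k x); last by rewrite kK.
by rewrite mem_box leNgt; apply: contraNN Fx => /sFh /=; rewrite kK => ->.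
Qed.

(* Z^2 is the disjoint union of the images of (i, j) |-> (i + j, i - j) and
   (i, j) |-> (i + j + 1, i - j), according to the parity of m - n. *)
Lemma zsum2_lattice K (F : int -> int -> V) :
  (forall m n, (K%:Z < `|m|) || (K%:Z < `|n|) -> F m n = 0) ->
  zsum K (fun m => zsum K (F m)) =
  zsum K (fun i => zsum K (fun j => F (i + j) (i - j))) +
  zsum K (fun i => zsum K (fun j => F (i + j + 1) (i - j))).
Proof.
move=> sF; rewrite /zsum.
have pair (G : int -> int -> V) : \sum_(m <- box K) \sum_(n <- box K) G m n =
   \sum_(x <- [seq (m, n) | m <- box K, n <- box K]) G x.1 x.2.
  by rewrite big_allpairs.
rewrite !pair; set s := [seq _ | _ <- _, _ <- _].
have Us : uniq s.
  by apply: allpairs_uniq; rewrite ?box_uniq // => [[? ?] [? ?]] /=.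
have mem_s x : (x \in s) = (`|x.1| <= K%:Z) && (`|x.2| <= K%:Z).
  rewrite -!mem_box; apply/allpairsP/andP => [[y [? ? ->]] // | [? ?]].
  by exists x; split=> //; apply: surjective_pairing.
clearbody s.
pose h0 (x : int * int) := (x.1 + x.2, x.1 - x.2).
pose h1 (x : int * int) := (x.1 + x.2 + 1, x.1 - x.2).
rewrite -[X in _ = X + _](big_map h0 xpredT (fun x => F x.1 x.2)).
rewrite -[X in _ = _ + X](big_map h1 xpredT (fun x => F x.1 x.2)) -big_cat.
have h0_inj : injective h0 by move=> [a b] [c d] [] ? ?; congr (_, _); lia.
have h1_inj : injective h1 by move=> [a b] [c d] [] ? ?; congr (_, _); lia.
apply: eq_sum_support => //.
  rewrite cat_uniq (map_inj_uniq h0_inj) (map_inj_uniq h1_inj) Us andTb andbT.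
  apply/hasPn => _ /mapP [[a b] _ ->].
  by apply/mapP => [[[c d] _ []]]; lia.
move=> [m n] /= Fmn.
have /andP [hm hn] : (`|m| <= K%:Z) && (`|n| <= K%:Z).
  by apply: contraNT Fmn => H; apply/eqP/sF; lia.
rewrite mem_s /= hm hn mem_cat; symmetry; apply/orP.
(* The preimage consists of the halves, rounded down, of m + n and m - n, so it stays in the box. *)
have [j [E|E]] : exists j : int, m - n = 2 * j \/ m - n = 2 * j + 1.
  by exists ((m - n) %/ 2)%Z; lia.
- left; apply/mapP; exists (n + j, j); last by rewrite /h0 /=; congr (_, _); lia.
  by rewrite mem_s /=; lia.
- right; apply/mapP; exists (n + j, j); last by rewrite /h1 /=; congr (_, _); lia.
  by rewrite mem_s /=; lia.
Qed.

End BilateralSums.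

Section RingSums.
Variable R : comNzRingType.

Lemma zsum_prod K (f g : int -> R) :
  zsum K (fun i => zsum K (fun j => f i * g j)) = zsum K f * zsum K g.
Proof.
by rewrite /zsum mulr_suml; apply: eq_bigr => i _; rewrite mulr_sumr.
Qed.

End RingSums.

(** * Theta series and logarithmic derivatives *)

Section Nilpotent.
Variables (R : comNzRingType) (M : nat).
Implicit Types p x y t : R.

Lemma expr_nil t n : t ^+ M = 0 -> (M <= n)%N -> t ^+ n = 0.
Proof. by move=> t0 /subnK <-; rewrite exprD t0 mulr0. Qed.

Lemma lreg_1sub t : t ^+ M = 0 -> GRing.lreg (1 - t).
Proof.
move=> t0 u v E; have := subrX1 t M; rewrite t0 => H.
have V : (\sum_(i < M) t ^+ i) * (1 - t) = 1 by rewrite -[1 in RHS]opprK -[- 1]sub0r H; ring.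
by rewrite -[u]mul1r -[v]mul1r -V -!mulrA E.
Qed.

Lemma lreg_prod n (F : nat -> R) : (forall j, GRing.lreg (F j)) ->
  GRing.lreg (\prod_(j < n) F j).
Proof.
by move=> HF; apply: big_ind => //; [exact: lreg1 | move=> ? ? ? ?; exact: lregM].
Qed.

Lemma lreg_poch p n : p ^+ M = 0 -> GRing.lreg (poch p n).
Proof.
move=> p0; apply: (lreg_prod _ (F := fun j => 1 - p ^+ j.+1)) => j.
by apply: lreg_1sub; rewrite -exprM mulnC exprM p0 expr0n.
Qed.

(** Factors with exponent at least M equal 1, so every long enough [poch p n] represents (p;
    p)_oo. *)
Lemma poch_stable p n : p ^+ M = 0 -> (M <= n.+1)%N -> poch p n = poch p M.-1.
Proof.
move=> p0; elim: n => [|n IH] le_M; first by have -> : M.-1 = 0%N by lia.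
have [le_Mn|lt_nM] := leqP M n.+1; last by have -> : M.-1 = n.+1 by lia.
by rewrite pochS IH // expr_nil ?subr0 ?mulr1 //; lia.
Qed.

(** The terms of Ramanujan's theta function f(-x, -y). *)
Definition theta_term x y (m : int) : R :=
  (-1) ^+ `|m|%N * (x ^+ tri (m + 1) * y ^+ tri m).

(** Since N exceeds 2 M, both k and 2 N - k are at least M whenever |k - N| <= M, as stability of
    the q-binomials requires. *)
Local Notation N := (2 * M).+2.

Lemma theta_term_supported x y : (x * y) ^+ M = 0 ->
  supported M (theta_term x y).
Proof.
move=> p0 m lt_Mm; rewrite /theta_term.
have H1 := mul2_tri m; have H2 := mul2_tri (m + 1).
have le1 : (M <= tri m)%N by nia.
have le2 : (M <= tri (m + 1))%N by nia.
rewrite -(subnK le1) -(subnK le2) !exprD.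
have -> : forall a b s, s * (a * x ^+ M * (b * y ^+ M)) = s * a * b * (x * y) ^+ M.
  by move=> a b s; rewrite exprMn; ring.
by rewrite p0 mulr0.
Qed.

(** For |k - N| <= M all the products in [qbin_poch] have the stable value, so [qbin] times [poch]
    is 1; for other k the theta term vanishes. *)
Lemma jtp_coef_poch x y (k : nat) : (x * y) ^+ M = 0 -> (k <= N + N)%N ->
  poch (x * y) N * jtp_coef x y N N k = theta_term x y (k%:Z - N%:Z).
Proof.
move=> p0 le_k; have sgn : (-1) ^+ (k + N) = (-1) ^+ `|k%:Z - N%:Z|%N :> R.
  by rewrite -signr_odd -[RHS]signr_odd; congr ((-1) ^+ _); lia.
have -> : poch (x * y) N * jtp_coef x y N N k =
    (qbin (x * y) (N + N) k * poch (x * y) N) * theta_term x y (k%:Z - N%:Z).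
  by rewrite /jtp_coef /theta_term sgn; ring.
have [le_M|lt_M] := leP `|k%:Z - N%:Z| M%:Z; last first.
  by rewrite theta_term_supported // mulr0.
have := @qbin_poch _ (x * y) _ _ le_k.
have st n : (M <= n)%N -> poch (x * y) n = poch (x * y) N.
  by move=> le_n; rewrite !(poch_stable p0) //; lia.
rewrite (st k); last by lia.
rewrite (st (N + N - k)%N); last by lia.
rewrite (st (N + N)%N); last by lia.
by rewrite mulrCA -[RHS]mulr1 => /(lreg_poch p0) ->; rewrite mul1r.
Qed.

Lemma jtp x y : (x * y) ^+ M = 0 ->
  poch (x * y) N * jtp_prod x y 1 N N = zsum N (theta_term x y).
Proof.
move=> p0; rewrite finite_jtp zsum_ord mulr_sumr.
have -> : (2 * N = N + N)%N by lia.
apply: eq_bigr => i _; rewrite expr1n mulr1 jtp_coef_poch //.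
by case: i => i /=; lia.
Qed.

Lemma jtp_coefC x y a b k : jtp_coef x%:P y%:P a b k = (jtp_coef x y a b k)%:P.
Proof.
have qbinC p n j : qbin p%:P n j = (qbin p n j)%:P.
  by elim: n j => [|n IH] [|j] //=; rewrite ?polyC0 // !IH polyCD polyCM rmorphXn.
by rewrite /jtp_coef -polyCM qbinC !polyCM !rmorphXn /= polyCN polyC1.
Qed.

Definition jtp_poly x y : {poly R} := jtp_prod x%:P y%:P 'X N N.

(* The powers of the Euler operator z d/dz, evaluated at z = 1. *)
Definition euler1 (F : {poly R}) := F^`().[1].
Definition euler2 (F : {poly R}) := F^`().[1] + F^`()^`().[1].

(** Clearing z^N attaches the theta term of index m to z^(m + N), hence the weights m + N. *)
Lemma jtp_moments x y (c := fun i => zsum N (fun m => (m + N%:Z)%:~R ^+ i * theta_term x y m)) :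
  (x * y) ^+ M = 0 ->
  [/\ poch (x * y) N * (jtp_poly x y).[1] = c 0,
      poch (x * y) N * euler1 (jtp_poly x y) = c 1 &
      poch (x * y) N * euler2 (jtp_poly x y) = c 2].
Proof.
move=> p0; rewrite /jtp_poly finite_jtp /c !zsum_ord.
have N2 : (2 * N = N + N)%N by lia.
have term (i : 'I_(N + N).+1) j : (i%:Z - N%:Z + N%:Z)%:~R ^+ j * theta_term x y (i%:Z - N%:Z) =
    poch (x * y) N * ((i%:R ^+ j) * jtp_coef x y N N i).
  rewrite subrK -jtp_coef_poch //; first by rewrite mulrCA.
  by case: i => i /=; lia.
under eq_bigr => i _ do rewrite jtp_coefC mul_polyC.
rewrite N2; split; under [RHS]eq_bigr => i _ do rewrite term.
- rewrite -mulr_sumr horner_sum; congr (_ * _); apply: eq_bigr => i _.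
  by rewrite hornerZ hornerXn expr1n expr0 mulr1 mul1r.
- rewrite -mulr_sumr /euler1 linear_sum /= horner_sum; congr (_ * _); apply: eq_bigr => i _.
  by rewrite derivZ derivXn hornerZ hornerMn hornerXn expr1n expr1 mulrC.
- rewrite -mulr_sumr /euler2 linear_sum /= linear_sum /= !horner_sum -big_split; congr (_ * _).
  apply: eq_bigr => i _ /=.
  rewrite !derivZ !derivXn derivMn derivXn !hornerZ !hornerMn !hornerXn !expr1n.
  by case: (i : nat) => [|k] /=; ring.
Qed.

(** This is -F^2 (z d/dz)^2 log F at z = 1, with denominators cleared. *)
Definition log_deriv2 (F : {poly R}) := euler1 F ^+ 2 - F.[1] * euler2 F.

Lemma log_deriv2M F G :
  log_deriv2 (F * G) = F.[1] ^+ 2 * log_deriv2 G + G.[1] ^+ 2 * log_deriv2 F.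
Proof.
rewrite /log_deriv2 /euler1 /euler2 !derivM !derivD !derivM !hornerD !hornerM.
ring.
Qed.

Lemma log_deriv2_prod n (F : nat -> {poly R}) (L : nat -> R) :
  (forall j, log_deriv2 (F j) = (F j).[1] ^+ 2 * L j) ->
  log_deriv2 (\prod_(j < n) F j) = (\prod_(j < n) F j).[1] ^+ 2 * \sum_(j < n) L j.
Proof.
move=> FL; elim: n => [|n IH].
  by rewrite !big_ord0 /log_deriv2 /euler1 /euler2 -[1]/(1%:P) !derivC !hornerC; ring.
by rewrite !big_ord_recr /= log_deriv2M IH FL hornerM; ring.
Qed.

Lemma log_deriv2_1subCX t : log_deriv2 (1 - t%:P * 'X) = t.
Proof.
have -> : 1 - t%:P * 'X = - (t%:P * ('X - (1 : R)%:P) + (t - 1)%:P).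
  by rewrite polyCB; ring.
rewrite /log_deriv2 /euler1 /euler2 derivN derivD derivM !derivC derivB derivX derivC.
rewrite subr0 mul0r add0r mulr1 addr0 derivN derivC oppr0.
rewrite !(hornerN, hornerD, hornerM, hornerC, hornerX); ring.
Qed.

Lemma log_deriv2_XsubC t : log_deriv2 ('X - t%:P) = t.
Proof.
rewrite /log_deriv2 /euler1 /euler2 derivB derivX derivC subr0 -[1]/(1%:P) derivC.
by rewrite !hornerD !hornerN !hornerC hornerX; ring.
Qed.

(** The series of t / (1 - t)^2, cut off before t^M. *)
Definition koebe t : R := \sum_(d < M) t ^+ d *+ d.

Lemma koebeE t : t ^+ M = 0 -> (1 - t) ^+ 2 * koebe t = t.
Proof.
move=> t0.
suff H n : (1 - t) ^+ 2 * (\sum_(d < n) t ^+ d *+ d) =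
    t + n%:R * t ^+ n * (t - 1) - t * t ^+ n.
  by rewrite /koebe H t0 !mulr0 mul0r subr0 addr0.
elim: n => [|n IH]; first by rewrite big_ord0; ring.
rewrite big_ord_recr /= mulrDr IH -[t ^+ n *+ n]mulr_natr (exprS t n) -natr1; ring.
Qed.

Lemma theta_log_derivative x y : x ^+ M = 0 -> y ^+ M = 0 ->
  zsum N (fun m => zsum N (fun n =>
    (m - n)%:~R ^+ 2 * (theta_term x y m * theta_term x y n))) =
  - (zsum N (theta_term x y) ^+ 2 *
     (\sum_(j < N) (koebe (x * (x * y) ^+ j) + koebe (y * (x * y) ^+ j)))) *+ 2.
Proof.
move=> x0 y0; have p0 : (x * y) ^+ M = 0 by rewrite exprMn x0 mul0r.
have [] := jtp_moments p0.
set c0 := zsum _ _; set c1 := zsum _ _; set c2 := zsum _ _ => E0 E1 E2.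
have -> : zsum N (theta_term x y) = c0.
  by apply: eq_zsum => m; rewrite expr0 mul1r.
have nil u j : u ^+ M = 0 -> (u * (x * y) ^+ j) ^+ M = 0.
  by move=> u0; rewrite exprMn u0 mul0r.
have W : log_deriv2 (jtp_poly x y) = (jtp_poly x y).[1] ^+ 2 *
    (\sum_(j < N) (koebe (x * (x * y) ^+ j) + koebe (y * (x * y) ^+ j))).
  rewrite /jtp_poly /jtp_prod log_deriv2M hornerM.
  rewrite (@log_deriv2_prod _ (fun j => 1 - 'X * x%:P * (x%:P * y%:P) ^+ j)
     (fun j => koebe (x * (x * y) ^+ j))); last first.
    move=> j; have -> : 1 - 'X * x%:P * (x%:P * y%:P) ^+ j =
      1 - (x * (x * y) ^+ j)%:P * 'X by rewrite polyCM rmorphXn /= polyCM; ring.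
    by rewrite log_deriv2_1subCX !hornerE koebeE ?nil.
  rewrite (@log_deriv2_prod _ (fun j => 'X - y%:P * (x%:P * y%:P) ^+ j)
     (fun j => koebe (y * (x * y) ^+ j))); last first.
    move=> j; have -> : 'X - y%:P * (x%:P * y%:P) ^+ j =
      'X - (y * (x * y) ^+ j)%:P by rewrite polyCM rmorphXn /= polyCM; ring.
    by rewrite log_deriv2_XsubC !hornerE koebeE ?nil.
  by rewrite big_split /=; ring.
(* The sum of the (m - n)^2 is 2 (c0 c2 - c1^2) for moments about any origin, so the shift by N
   disappears. *)
transitivity (c2 * c0 - c1 * c1 *+ 2 + c0 * c2).
  rewrite /c0 /c1 /c2 -!zsum_prod /zsum -sumrMnl -sumrB -big_split /=.
  apply: eq_bigr => m _; rewrite -sumrMnl -sumrB -big_split /=.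
  apply: eq_bigr => n _; rewrite !rmorphD rmorphN /=; ring.
have := congr1 (fun u => poch (x * y) N ^+ 2 * u) W.
rewrite /log_deriv2 -E0 -E1 -E2 => /= H.
transitivity (- (poch (x * y) N ^+ 2 *
  (euler1 (jtp_poly x y) ^+ 2 - (jtp_poly x y).[1] * euler2 (jtp_poly x y))) *+ 2).
  ring.
by rewrite H; ring.
Qed.

End Nilpotent.

(** * Parity splitting of the theta series *)

Section Jacobi.
Variables (R : comNzRingType) (M : nat).
Implicit Types p x y t : R.
Local Notation N := (2 * M).+2.

(** Jacobi's formula for (p; p)_oo^3: at y = 1 the triple product has the factor z - 1, so its
    derivative at z = 1 is the value of the cofactor. The terms m and -1 - m agree, which gives the
    factor 2. *)
Lemma jacobi_cube p : p ^+ M = 0 ->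
  zsum N (fun m => (m *+ 2 + 1)%:~R * theta_term p 1 m) = poch p N ^+ 3 *+ 2.
Proof.
move=> p0; have p10 : (p * 1) ^+ M = 0 by rewrite mulr1.
have [] := jtp_moments p10; rewrite mulr1.
set c0 := zsum _ _; set c1 := zsum _ _; set c2 := zsum _ _ => E0 E1 _.
pose G : {poly R} := (\prod_(j < N) (1 - 'X * p%:P * (p%:P * 1%:P) ^+ j)) *
   \prod_(j < N.-1) ('X - (p%:P * 1%:P) ^+ j.+1).
have EQ : jtp_poly M p 1 = ('X - (1 : R)%:P) * G.
  rewrite /jtp_poly /jtp_prod /G [X in _ * X]big_ord_recl expr0 mulr1.
  rewrite mulrCA; congr (_ * (_ * _)); apply: eq_bigr => i _.
  by rewrite mul1r lift0.
have G1 : G.[1] = poch p N * poch p N.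
  have pst n : (M <= n.+1)%N -> poch p n = poch p N.
    by move=> le_n; rewrite !(poch_stable p0) //; lia.
  rewrite -{2}(pst N.-1); last by lia.
  rewrite /G hornerM !horner_prod polyC1 mulr1; congr (_ * _); apply: eq_bigr => i _.
    rewrite ?mulr1 -rmorphXn /= hornerD hornerN !hornerM !hornerC hornerX exprS.
    by rewrite mul1r.
  by rewrite ?mulr1 -rmorphXn /= hornerD hornerN !hornerC hornerX.
clearbody G; have Q1 : (jtp_poly M p 1).[1] = 0.
  by rewrite EQ hornerM hornerXsubC subrr mul0r.
have Q2 : euler1 (jtp_poly M p 1) = G.[1].
  by rewrite /euler1 EQ derivM derivXsubC mul1r hornerD hornerM hornerXsubC; ring.
transitivity (c1 *+ 2 + (1 - N%:R *+ 2) * c0).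
  rewrite /c0 /c1 /zsum mulr_sumr -sumrMnl -big_split /=.
  by apply: eq_bigr => m _; ring.
by rewrite -E0 -E1 Q1 Q2 G1; ring.
Qed.

End Jacobi.

Section Lattice.
Variables (R : comNzRingType) (M : nat) (q : R).
Hypothesis q0 : q ^+ M = 0.
Local Notation N := (2 * M).+2.

(** Equal to (a + b) m (m - 1) / 2 + a m, that is g_a(m) when a + b = 5. *)
Definition gexp (a b : nat) (m : int) : nat := (a * tri (m + 1) + b * tri m)%N.

Lemma theta_termN a b m : theta_term (- q ^+ a) (- q ^+ b) m = q ^+ gexp a b m.
Proof.
rewrite /theta_term (exprNn (q ^+ a)) (exprNn (q ^+ b)) -!exprM exprD.
have : odd (`|m| + (tri (m + 1) + tri m)) = false.
  by have := mul2_tri m; have := mul2_tri (m + 1); lia.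
move=> E; have S : (-1) ^+ `|m|%N * ((-1) ^+ tri (m + 1) * (-1) ^+ tri m) = 1 :> R.
  by rewrite -!exprD -signr_odd E.
by rewrite -[RHS]mul1r -[X in _ = X * _]S; ring.
Qed.

Lemma theta_termP a b m :
  theta_term (q ^+ a) (q ^+ b) m = (-1) ^+ `|m|%N * q ^+ gexp a b m.
Proof. by rewrite /theta_term -!exprM exprD. Qed.

Lemma gexp_large a b m : (0 < a + b)%N -> M%:Z < `|m| -> q ^+ gexp a b m = 0.
Proof.
move=> ab lt_m; apply: expr_nil q0 _.
have le1 : (M <= tri (m + 1))%N by have := mul2_tri (m + 1); nia.
have le2 : (M <= tri m)%N by have := mul2_tri m; nia.
case: a ab => [|a] ab; first by rewrite /gexp add0n (leq_trans le2) // leq_pmull.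
by rewrite (leq_trans le1) // (leq_trans (leq_pmull _ (ltn0Sn a))) // leq_addr.
Qed.

(** For a + b = 5, [gsum], [Asum] and [Bsum] are theta_a, A_a and B_a. *)
Definition gsum a b := zsum N (fun m => q ^+ gexp a b m).
Definition Asum a b := zsum N (fun i => q ^+ (2 * gexp a b i)).
Definition Bsum a b := zsum N (fun i => q ^+ (gexp a b (i + 1) + gexp a b i)).
(** Weighted sums over the even and the odd values of m - n; the exponents are 5 j^2 and 5 j (j +
    1). *)
Definition evensum (w : int -> R) := zsum N (fun j => w (j *+ 2) * q ^+ gexp 5 5 j).
Definition oddsum (w : int -> R) := zsum N (fun j => w (j *+ 2 + 1) * q ^+ gexp 10 0 j).

(** Both halves of the lattice factor, because g(i + j) + g(i - j) = 2 g(i) + 5 j^2 and g(i + j + 1)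
    + g(i - j) = g(i + 1) + g(i) + 5 j (j + 1). *)
Lemma gsum2 a b (w : int -> R) : (a + b = 5)%N ->
  zsum N (fun m => zsum N (fun n => w (m - n) * (q ^+ gexp a b m * q ^+ gexp a b n))) =
  Asum a b * evensum w + Bsum a b * oddsum w.
Proof.
move=> ab; rewrite zsum2_lattice; last first.
  move=> m n H; suff -> : q ^+ gexp a b m * q ^+ gexp a b n = 0 by rewrite mulr0.
  case/orP: H => H; first by rewrite gexp_large ?ab ?mul0r //; lia.
  by rewrite mulrC gexp_large ?ab ?mul0r //; lia.
rewrite -!zsum_prod; congr (_ + _); apply: eq_zsum => i; apply: eq_zsum => j.
- have -> : i + j - (i - j) = j *+ 2 by lia.
  rewrite [RHS]mulrCA -!exprD; congr (_ * q ^+ _).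
  have Eb : b = (5 - a)%N by lia.
  have := mul2_tri (i + j); have := mul2_tri (i + j + 1).
  have := mul2_tri (i - j); have := mul2_tri (i - j + 1).
  have := mul2_tri i; have := mul2_tri (i + 1).
  have := mul2_tri j; have := mul2_tri (j + 1); rewrite /gexp.
  have : (a <= 5)%N by lia.
  rewrite {}Eb; case: a {ab} => [|[|[|[|[|[|a]]]]]] //; lia.
- have -> : i + j + 1 - (i - j) = j *+ 2 + 1 by lia.
  rewrite [RHS]mulrCA -!exprD; congr (_ * q ^+ _).
  have Eb : b = (5 - a)%N by lia.
  have := mul2_tri (i + j + 1); have := mul2_tri (i + j + 1 + 1).
  have := mul2_tri (i - j); have := mul2_tri (i - j + 1).
  have := mul2_tri i; have := mul2_tri (i + 1); have := mul2_tri (i + 1 + 1).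
  have := mul2_tri j; have := mul2_tri (j + 1); rewrite /gexp.
  have : (a <= 5)%N by lia.
  rewrite {}Eb; case: a {ab} => [|[|[|[|[|[|a]]]]]] //; lia.
Qed.

Lemma zsum_shift (F : int -> R) : supported M F ->
  zsum N F = zsum N (fun i => F (i + 1)).
Proof.
move=> sF; apply: (@zsum_reindex _ _ (fun i => i + 1) (fun i => i - 1)).
- by move=> i; rewrite addrK.
- by move=> i; rewrite subrK.
- by move=> m lt_m; apply: sF; lia.
- by move=> m lt_m; apply: sF; lia.
Qed.

Lemma signz (m n : int) (e : bool) : (exists k : int, m + n = k *+ 2 + e%:Z) ->
  (-1) ^+ `|m|%N * (-1) ^+ `|n|%N = (-1) ^+ e :> R.
Proof.
case=> k E; rewrite -exprD -signr_odd -[RHS]signr_odd; congr ((-1) ^+ _).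
by case: e E; lia.
Qed.

(** The sign of a pair (m, n) is + when m - n is even and - when it is odd, which yields the
    difference. By the triple product the left side is q f_1 f_5. *)
Lemma gsum_alternating :
  q * (zsum N (theta_term (q ^+ 3) (q ^+ 2)) * zsum N (theta_term (q ^+ 4) (q ^+ 1))) =
  Asum 2 3 * Bsum 1 4 - Asum 1 4 * Bsum 2 3.
Proof.
rewrite -zsum_prod zsum2_lattice; last first.
  move=> m n /orP [] H; rewrite !theta_termP.
    by rewrite gexp_large ?mulr0 ?mul0r //; lia.
  by rewrite [X in _ * (_ * X)]gexp_large ?mulr0 ?mul0r //; lia.
(* The odd half produces the terms of A_1 at i + 1. *)
have -> : Asum 1 4 = zsum N (fun i => q ^+ (2 * gexp 1 4 (i + 1))).
  by rewrite /Asum zsum_shift // => m H; rewrite mulnC exprM gexp_large // expr0n.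
rewrite mulrDr; congr (_ + _).
- rewrite [RHS]mulrC -zsum_prod /zsum mulr_sumr; apply: eq_bigr => i _.
  rewrite mulr_sumr; apply: eq_bigr => j _.
  rewrite !theta_termP mulrACA (@signz _ _ false); last by exists i; lia.
  rewrite expr0 mul1r -!exprD -exprS; congr (q ^+ _).
  have := mul2_tri (i + j); have := mul2_tri (i + j + 1).
  have := mul2_tri (i - j); have := mul2_tri (i - j + 1).
  have := mul2_tri i; have := mul2_tri (i + 1); have := mul2_tri (i + 1 + 1).
  have := mul2_tri j; have := mul2_tri (j + 1); rewrite /gexp; lia.
- rewrite -zsum_prod /zsum -sumrN mulr_sumr; apply: eq_bigr => i _.
  rewrite -sumrN mulr_sumr; apply: eq_bigr => j _.
  rewrite !theta_termP mulrACA (@signz _ _ true); last by exists i; lia.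
  rewrite /= expr1 mulN1r mulrN -!exprD -exprS; congr (- q ^+ _).
  have := mul2_tri (i + j + 1); have := mul2_tri (i + j + 1 + 1).
  have := mul2_tri (i - j); have := mul2_tri (i - j + 1).
  have := mul2_tri i; have := mul2_tri (i + 1); have := mul2_tri (i + 1 + 1).
  have := mul2_tri j; have := mul2_tri (j + 1); have := mul2_tri (j + 1 + 1).
  rewrite /gexp; lia.
Qed.

(** The weights factor as differences of squares, (2i + 1)^2 - (2j)^2 on the even half and (2i +
    2)^2 - (2j + 1)^2 on the odd half. The sign -1 of the odd half makes the two contributions
    equal. *)
Lemma cubic_sum2 (sq := fun m : int => m%:~R ^+ 2 : R) (one := fun _ : int => 1 : R) :
  zsum N (fun m => (m *+ 2 + 1)%:~R * theta_term (q ^+ 5) 1 m) ^+ 2 =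
  (oddsum sq * evensum one - oddsum one * evensum sq) *+ 2.
Proof.
rewrite expr2 -zsum_prod zsum2_lattice; last first.
  move=> m n /orP [] H; rewrite -(expr0 q) !theta_termP.
    by rewrite gexp_large ?mulr0 ?mul0r //; lia.
  by rewrite [X in _ * (_ * (_ * X))]gexp_large ?mulr0 ?mul0r //; lia.
rewrite -(expr0 q) mulr2n; congr (_ + _).
- rewrite -!zsum_prod /zsum -sumrB; apply: eq_bigr => i _.
  rewrite -sumrB; apply: eq_bigr => j _.
  have E : q ^+ gexp 5 0 (i + j) * q ^+ gexp 5 0 (i - j) = q ^+ gexp 10 0 i * q ^+ gexp 5 5 j.
    rewrite -!exprD; congr (q ^+ _).
    have := mul2_tri (i + j); have := mul2_tri (i + j + 1).
    have := mul2_tri (i - j); have := mul2_tri (i - j + 1).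
    have := mul2_tri i; have := mul2_tri (i + 1).
    have := mul2_tri j; have := mul2_tri (j + 1); rewrite /gexp; lia.
  have S : (-1) ^+ `|(i + j)%R|%N * (-1) ^+ `|(i - j)%R|%N = 1 :> R.
    by rewrite (@signz _ _ false) //; exists i; lia.
  rewrite !theta_termP /sq /one.
  transitivity ((((i + j) *+ 2 + 1)%:~R * ((i - j) *+ 2 + 1)%:~R) *
    ((-1) ^+ `|(i + j)%R|%N * (-1) ^+ `|(i - j)%R|%N) *
    (q ^+ gexp 5 0 (i + j) * q ^+ gexp 5 0 (i - j))); first by ring.
  by rewrite S E; ring.
(* On the odd half the even number is 2 (i + 1), so the even sums are shifted by one. *)
have -> : evensum sq = zsum N (fun j => sq ((j + 1) *+ 2) * q ^+ gexp 5 5 (j + 1)).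
  by rewrite /evensum zsum_shift // => m H; rewrite gexp_large ?mulr0.
have -> : evensum one = zsum N (fun j => one ((j + 1) *+ 2) * q ^+ gexp 5 5 (j + 1)).
  by rewrite /evensum zsum_shift // => m H; rewrite gexp_large ?mulr0.
rewrite ![oddsum _ * _]mulrC.
rewrite -!zsum_prod /zsum -sumrB; apply: eq_bigr => i _.
rewrite -sumrB; apply: eq_bigr => j _.
have E : q ^+ gexp 5 0 (i + j + 1) * q ^+ gexp 5 0 (i - j) =
    q ^+ gexp 5 5 (i + 1) * q ^+ gexp 10 0 j.
  rewrite -!exprD; congr (q ^+ _).
  have := mul2_tri (i + j + 1); have := mul2_tri (i + j + 1 + 1).
  have := mul2_tri (i - j); have := mul2_tri (i - j + 1).
  have := mul2_tri (i + 1); have := mul2_tri (i + 1 + 1).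
  have := mul2_tri j; have := mul2_tri (j + 1); rewrite /gexp; lia.
have S : (-1) ^+ `|(i + j + 1)%R|%N * (-1) ^+ `|(i - j)%R|%N = -1 :> R.
  by rewrite (@signz _ _ true) //; exists i; lia.
rewrite !theta_termP /sq /one.
transitivity ((((i + j + 1) *+ 2 + 1)%:~R * ((i - j) *+ 2 + 1)%:~R) *
  ((-1) ^+ `|(i + j + 1)%R|%N * (-1) ^+ `|(i - j)%R|%N) *
  (q ^+ gexp 5 0 (i + j + 1) * q ^+ gexp 5 0 (i - j))); first by ring.
by rewrite S E; ring.
Qed.

End Lattice.

(** * The Lambert series of the crank *)

Section Products.
Variables (R : comNzRingType).

Lemma prod_mod2 n (F : nat -> R) :
  \prod_(j < 2 * n) F j = \prod_(j < n) F (2 * j)%N * \prod_(j < n) F (2 * j + 1)%N.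
Proof.
elim: n => [|n IH]; first by rewrite !big_ord0 mulr1.
rewrite mulnS addnC addn2 !big_ord_recr /= IH.
rewrite ?addn1; ring.
Qed.

Lemma prod_mod5 n (F : nat -> R) :
  \prod_(j < 5 * n) F j =
  \prod_(j < n) F (5 * j)%N * \prod_(j < n) F (5 * j + 1)%N *
  \prod_(j < n) F (5 * j + 2)%N * \prod_(j < n) F (5 * j + 3)%N *
  \prod_(j < n) F (5 * j + 4)%N.
Proof.
elim: n => [|n IH]; first by rewrite !big_ord0 !mulr1.
have -> : (5 * n.+1 = (5 * n).+4.+1)%N by lia.
by rewrite !big_ord_recr /= IH ?addn1 ?addn2 ?addn3 ?addn4; ring.
Qed.

Definition pochN (p : R) n : R := \prod_(j < n) (1 + p ^+ j.+1).

Lemma poch_pochN p n : pochN p n * poch p n = poch (p ^+ 2) n.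
Proof.
rewrite /poch /pochN -big_split /=; apply: eq_bigr => j _.
by rewrite -exprM mulnC exprM; ring.
Qed.

End Products.

Section CrankLambert.
Variables (R : comNzRingType) (M : nat) (q : R).
Hypotheses (q0 : q ^+ M = 0) (reg2 : GRing.lreg (2%:R : R)).
Local Notation N := (2 * M).+2.

(* Since koebe(-q^n) = - q^n / (1 + q^n)^2, this is - E_a when a + b = 5. *)
Definition lambert a b :=
  \sum_(j < N) (koebe M (- q ^+ a * (q ^+ 5) ^+ j) + koebe M (- q ^+ b * (q ^+ 5) ^+ j)).

Let p0 : (q ^+ 5) ^+ M = 0. Proof. by rewrite -exprM mulnC exprM q0 expr0n. Qed.

Let nil a : (0 < a)%N -> (- q ^+ a) ^+ M = 0.
Proof. by move=> a0; rewrite exprNn -exprM mulnC exprM q0 expr0n eqn0Ngt a0 mulr0. Qed.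

Lemma theta_lambert a b (sq := fun m : int => m%:~R ^+ 2 : R) (one := fun _ : int => 1 : R) :
  (0 < a)%N -> (0 < b)%N -> (a + b = 5)%N ->
  gsum M q a b ^+ 2 = Asum M q a b * evensum M q one + Bsum M q a b * oddsum M q one /\
  - (gsum M q a b ^+ 2 * lambert a b) *+ 2 =
     Asum M q a b * evensum M q sq + Bsum M q a b * oddsum M q sq.
Proof.
move=> a0 b0 ab; split.
  rewrite -gsum2 // expr2 -zsum_prod /one; apply: eq_zsum => m; apply: eq_zsum => n.
  by rewrite mul1r.
have xy : - q ^+ a * - q ^+ b = q ^+ 5 by rewrite mulrNN -exprD ab.
have := theta_log_derivative (nil a0) (nil b0).
have -> : zsum N (theta_term (- q ^+ a) (- q ^+ b)) = gsum M q a b.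
  by apply: eq_zsum => m; rewrite theta_termN.
rewrite xy -/(lambert a b) => <-; rewrite -gsum2 //.
by apply: eq_zsum => m; apply: eq_zsum => n; rewrite !theta_termN.
Qed.

(** The relations of [theta_lambert] for a = 1, 2 are linear in A_a and B_a; cross-multiplying them
    leaves the product of the determinant A_2 B_1 - A_1 B_2 and the combination in [cubic_sum2]. *)
Lemma lambert_theta :
  - (gsum M q 1 4 ^+ 2 * gsum M q 2 3 ^+ 2 * (lambert 1 4 - lambert 2 3)) =
  poch (q ^+ 5) N ^+ 6 *
  (q * (zsum N (theta_term (q ^+ 3) (q ^+ 2)) * zsum N (theta_term (q ^+ 4) (q ^+ 1)))).
Proof.
have [G1 T1] := @theta_lambert 1 4 isT isT erefl.
have [G2 T2] := @theta_lambert 2 3 isT isT erefl.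
have := cubic_sum2 q0; rewrite (jacobi_cube p0) (gsum_alternating q0) => C.
(* One factor 2 comes from [theta_lambert], the other from [cubic_sum2]. *)
apply: reg2; apply: reg2.
transitivity ((- (gsum M q 1 4 ^+ 2 * lambert 1 4) *+ 2 * gsum M q 2 3 ^+ 2
  - (- (gsum M q 2 3 ^+ 2 * lambert 2 3) *+ 2) * gsum M q 1 4 ^+ 2) *+ 2); first by ring.
rewrite T1 T2 G1 G2.
transitivity ((poch (q ^+ 5) N ^+ 3 *+ 2) ^+ 2 *
  (Asum M q 2 3 * Bsum M q 1 4 - Asum M q 1 4 * Bsum M q 2 3)); last by ring.
by rewrite C; ring.
Qed.

(** The theta series on the left of [lambert_theta] multiply to f_5^2 times the product of 1 + q^n
    over n prime to 5, those on the right to the same with 1 - q^n. Supplying the multiples of 5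
    completes these to (-q; q) and (q; q). *)
Lemma lambert_prod :
  pochN q (5 * N) ^+ 2 * (lambert 1 4 - lambert 2 3) =
  - (q * poch q (5 * N) * poch (q ^+ 5) N * poch (q ^+ 10) N ^+ 2).
Proof.
pose P := poch (q ^+ 5) N.
have jtpN a b : (0 < a)%N -> (0 < b)%N -> (a + b = 5)%N ->
    gsum M q a b = P * (\prod_(j < N) (1 + q ^+ (5 * j + a)) *
                        \prod_(j < N) (1 + q ^+ (5 * j + b))).
  move=> a0 b0 ab; have xy : - q ^+ a * - q ^+ b = q ^+ 5 by rewrite mulrNN -exprD ab.
  have -> : gsum M q a b = zsum N (theta_term (- q ^+ a) (- q ^+ b)).
    by apply: eq_zsum => m; rewrite theta_termN.
  rewrite -jtp ?xy // /jtp_prod xy; congr (_ * (_ * _)); apply: eq_bigr => j _.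
    by rewrite -exprM exprD; ring.
  by rewrite -exprM exprD; ring.
have jtpP a b : (a + b = 5)%N -> zsum N (theta_term (q ^+ a) (q ^+ b)) =
     P * (\prod_(j < N) (1 - q ^+ (5 * j + a)) * \prod_(j < N) (1 - q ^+ (5 * j + b))).
  move=> ab; have xy : q ^+ a * q ^+ b = q ^+ 5 by rewrite -exprD ab.
  rewrite -jtp ?xy // /jtp_prod xy; congr (_ * (_ * _)); apply: eq_bigr => j _.
    by rewrite -exprM exprD; ring.
  by rewrite -exprM exprD; ring.
have := lambert_theta; rewrite !jtpN // !jtpP //.
have mod5 s : \prod_(j < 5 * N) (1 + s * q ^+ j.+1) =
    \prod_(j < N) (1 + s * q ^+ (5 * j + 1)) * \prod_(j < N) (1 + s * q ^+ (5 * j + 2)) *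
    \prod_(j < N) (1 + s * q ^+ (5 * j + 3)) * \prod_(j < N) (1 + s * q ^+ (5 * j + 4)) *
    \prod_(j < N) (1 + s * (q ^+ 5) ^+ j.+1).
  rewrite (@prod_mod5 _ N (fun j => 1 + s * q ^+ j.+1)).
  by do !congr (_ * _); apply: eq_bigr => j _; rewrite -?exprM;
    congr (1 + s * q ^+ _); lia.
have E1 : poch q (5 * N) = \prod_(j < 5 * N) (1 + (-1) * q ^+ j.+1).
  by apply: eq_bigr => j _; rewrite mulN1r.
have E2 : pochN q (5 * N) = \prod_(j < 5 * N) (1 + 1 * q ^+ j.+1).
  by apply: eq_bigr => j _; rewrite mul1r.
have -> : poch (q ^+ 10) N = pochN (q ^+ 5) N * P.
  by rewrite poch_pochN -exprM.
have E3 : \prod_(j < N) (1 + (-1) * (q ^+ 5) ^+ j.+1) = P.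
  by apply: eq_bigr => j _; rewrite mulN1r.
have E4 : \prod_(j < N) (1 + 1 * (q ^+ 5) ^+ j.+1) = pochN (q ^+ 5) N.
  by apply: eq_bigr => j _; rewrite mul1r.
have neg a : \prod_(j < N) (1 + (-1) * q ^+ (5 * j + a)) = \prod_(j < N) (1 - q ^+ (5 * j + a)).
  by apply: eq_bigr => j _; rewrite mulN1r.
have pos a : \prod_(j < N) (1 + 1 * q ^+ (5 * j + a)) = \prod_(j < N) (1 + q ^+ (5 * j + a)).
  by apply: eq_bigr => j _; rewrite mul1r.
rewrite E1 E2 !mod5 E3 E4 !neg !pos -/P.
(* The letters n and m stand for products of 1 + q^k and of 1 - q^k, the digit for the residue of k
   mod 5. *)
set n1 := \prod_(j < N) _; set n4 := \prod_(j < N) _; set n2 := \prod_(j < N) _;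
set n3 := \prod_(j < N) _; set m3 := \prod_(j < N) _; set m2 := \prod_(j < N) _;
set m4 := \prod_(j < N) _; set m1 := \prod_(j < N) _ => H.
have regP : GRing.lreg (P ^+ 4) by apply: lregX; apply: lreg_poch p0.
apply: oppr_inj; apply: regP.
transitivity (pochN (q ^+ 5) N ^+ 2 *
  - ((P * (n1 * n4)) ^+ 2 * (P * (n2 * n3)) ^+ 2 * (lambert 1 4 - lambert 2 3))).
  ring.
by rewrite H; ring.
Qed.

(** (-q; q)_n is the quotient of (q^2; q^2)_n by (q; q)_n, and both are stable. *)
Lemma pochN_stable n : (M <= n.+1)%N -> pochN q n = pochN q M.-1.
Proof.
have q20 : (q ^+ 2) ^+ M = 0 by rewrite -exprM mulnC exprM q0 expr0n.
move=> le_M; have reg := @lreg_poch _ _ _ M.-1 q0; apply: reg; rewrite mulrC [RHS]mulrC.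
by rewrite -{1}(poch_stable q0 le_M) !poch_pochN !(poch_stable q20) //; lia.
Qed.

(** Multiplying [lambert_prod] by V^2 divides it by (-q; q)_oo^2; since f_2 = f_1 (-q; q)_oo, this
    is the key identity. *)
Lemma crank_lambert (V : R) : V * pochN q N = 1 ->
  q * (poch q N * V ^+ 2 * (poch (q ^+ 5) N * poch (q ^+ 10) N ^+ 2)) =
  lambert 2 3 - lambert 1 4.
Proof.
have st : pochN q N = pochN q (5 * N) by rewrite !pochN_stable //; lia.
have -> : poch q N = poch q (5 * N) by rewrite !(poch_stable q0) //; lia.
rewrite st => VP.
transitivity (- (V ^+ 2 * (pochN q (5 * N) ^+ 2 * (lambert 1 4 - lambert 2 3)))).
  by rewrite lambert_prod; ring.
by rewrite mulrA -exprMn VP expr1n mul1r opprB.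
Qed.

End CrankLambert.

Section Euler.
Variable R : comNzRingType.

(* With [o = (q; q^2)], [f1 = (q; q)], [f2 = (q^2; q^2)] and [w] the inverse of
   [h = (-q; q)], this uses Euler's identity [w = o]. *)
Lemma crank_rhs (o f1 f2 h v w f5 f10 : R) :
  w * h = 1 -> v * f2 = 1 -> o * f2 = f1 -> h * f1 = f2 -> GRing.lreg f1 ->
  5%:R * (f1 * w ^+ 2 * (f5 * f10 ^+ 2)) =
  f1 * f2 ^+ 2 * (5%:R * o ^+ 2 * f5 * f10 ^+ 2 * v ^+ 2).
Proof.
move=> wh vf of2 hf reg.
have -> : w = o by apply: reg; rewrite -[RHS]mul1r -wh -{1}of2 -hf; ring.
transitivity (5%:R * (f1 * o ^+ 2 * (f5 * f10 ^+ 2)) * (v * f2) ^+ 2); last by ring.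
by rewrite vf; ring.
Qed.

End Euler.

(** * Truncated power series *)

Section Truncation.
Variables (A : comNzRingType) (m : nat).
Local Notation M := m.+1.
Local Notation R := {poly %/ 'X^M : {poly A}}.

Definition trunc (p : {poly A}) : R := in_qpoly 'X^M p.
HB.instance Definition _ := GRing.RMorphism.copy trunc (in_qpoly ('X^M : {poly A})).

Lemma trunc_coefP (p r : {poly A}) :
  trunc p = trunc r <-> forall i, (i < M)%N -> p`_i = r`_i.
Proof.
have coef_mod (u : {poly A}) i : (i < M)%N -> (trunc u : {poly A})`_i = u`_i.
  move=> lt_i; rewrite /= mk_monic_Xn /=.
  rewrite [in RHS](Pdiv.RingMonic.rdivp_eq (monicXn _ M) u) coefD coefMXn lt_i.
  by rewrite add0r.
split=> [E i lt_i | E].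
  by rewrite -(coef_mod p) // -(coef_mod r) // E.
apply: val_inj; apply/polyP => i; have [lt_i|le_i] := ltnP i M.
  by rewrite !coef_mod // E.
have big (u : R) : (u : {poly A})`_i = 0.
  have szM : size (mk_monic ('X^M : {poly A})) = M.+1 by rewrite mk_monic_Xn size_polyXn.
  by apply: nth_default; have := size_mk_monic u; rewrite {2}szM ltnS => /leq_trans; apply.
by rewrite !big.
Qed.

Lemma truncX_nil : trunc 'X ^+ M = 0.
Proof.
rewrite -rmorphXn -(rmorph0 trunc); apply/trunc_coefP => i lt_i.
by rewrite coefXn coef0; case: eqP => // E; move: lt_i; rewrite E ltnn.
Qed.

Lemma lreg_trunc k : GRing.lreg (k%:R : A) -> GRing.lreg (k%:R : R).
Proof.
move=> regk u v E.
have truncK (w : R) : trunc (w : {poly A}) = w.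
  by apply: val_inj; apply: in_qpoly_small; apply: size_mk_monic.
rewrite -(truncK u) -(truncK v); apply/trunc_coefP => i lt_i; apply: regk.
have : trunc (k%:R * (u : {poly A})) = trunc (k%:R * (v : {poly A})).
  by rewrite !rmorphM rmorph_nat /= !truncK.
by move=> /trunc_coefP /(_ i lt_i); rewrite -polyC_natr !coefCM.
Qed.

End Truncation.

Section TruncatedProducts.
Variable m : nat.
Local Notation M := m.+1.
Local Notation R := {poly %/ 'X^M : {poly int}}.
Local Notation trunc := (@trunc int m).
Local Notation q := (trunc 'X).
Let q_nil : q ^+ M = 0 := @truncX_nil int m.

Lemma trunc_qpoch c a b K :
  trunc (qpoch c a b K) = \prod_(j < K.+1) (1 - c%:~R * q ^+ (a + b * j)).
Proof.
rewrite rmorph_prod; apply: eq_bigr => j _.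
rewrite rmorphB rmorph1 -mul_polyC rmorphM rmorphXn /=.
have -> : c%:P = c%:~R :> {poly int} by rewrite -{1}[c]intz rmorph_int.
by rewrite rmorph_int.
Qed.

Lemma trunc_qpoch1 d K : trunc (qpoch 1 d d K) = poch (q ^+ d) K.+1.
Proof.
rewrite trunc_qpoch; apply: eq_bigr => j _.
by rewrite mul1r -exprM mulnS.
Qed.

Lemma trunc_qpochN K : trunc (qpoch (-1) 1 1 K) = pochN q K.+1.
Proof.
rewrite trunc_qpoch; apply: eq_bigr => j _.
by rewrite mulN1r opprK mul1n.
Qed.

Lemma trunc_qpochinv c a b K : (0 < a)%N -> (m <= K)%N ->
  trunc (qpochinv c a b K) * trunc (qpoch c a b K) = 1.
Proof.
move=> a0 le_mK; rewrite -rmorphM -big_split rmorph_prod big1 // => j _ /=.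
set t : {poly int} := c *: 'X^(a + b * j).
have -> : \sum_(k < K.+1) c ^+ k *: 'X^((a + b * j) * k) = \sum_(k < K.+1) t ^+ k.
  by apply: eq_bigr => k _; rewrite exprZn -exprM.
(* The geometric sum leaves the remainder t^(K+1), of order at least m + 1 because a > 0, so
   truncation kills it. *)
have -> : (\sum_(k < K.+1) t ^+ k) * (1 - t) = 1 - t ^+ K.+1.
  by rewrite -[RHS]opprB subrX1; ring.
rewrite rmorphB rmorph1 rmorphXn /t -mul_polyC rmorphM /= rmorphXn /=.
rewrite exprMn -exprM (_ : q ^+ _ = 0) ?mulr0 ?subr0 //.
apply: expr_nil q_nil _; nia.
Qed.

Lemma qpoch_stable c a b K L : (0 < b)%N -> (m <= K)%N -> (m <= L)%N ->
  trunc (qpoch c a b K) = trunc (qpoch c a b L).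
Proof.
move=> b0; suff H n : (m <= n)%N -> trunc (qpoch c a b n) = trunc (qpoch c a b m).
  by move=> leK leL; rewrite !H.
elim: n => [|n IH]; first by rewrite leqn0 => /eqP ->.
rewrite leq_eqVlt => /predU1P [-> //|lt_mn].
rewrite -IH // !trunc_qpoch big_ord_recr /= (expr_nil q_nil) ?mulr0 ?subr0 ?mulr1 //.
nia.
Qed.

Lemma qpochinv_stable c a b K L : (0 < a)%N -> (0 < b)%N -> (m <= K)%N -> (m <= L)%N ->
  trunc (qpochinv c a b K) = trunc (qpochinv c a b L).
Proof.
move=> a0 b0 leK leL; rewrite -[LHS]mulr1 -(trunc_qpochinv c b a0 leL).
by rewrite mulrCA (qpoch_stable c a b0 leL leK) trunc_qpochinv // mulr1.
Qed.

Lemma trunc_crank_eo_gf K :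
  trunc (crank_eo_gf K) = trunc (qpoch 1 1 1 K) * trunc (qpochinv (-1) 1 1 K) ^+ 2.
Proof. by rewrite rmorphM rmorphXn. Qed.

Lemma trunc_rhs_gf K :
  trunc (rhs_gf K) = 5%:R * trunc (qpoch 1 1 2 K) ^+ 2 * trunc (qpoch 1 5 5 K) *
    trunc (qpoch 1 10 10 K) ^+ 2 * trunc (qpochinv 1 2 2 K) ^+ 2.
Proof. by rewrite !rmorphM rmorph_nat. Qed.

Lemma crank_eo_gf_stable K L : (m <= K)%N -> (m <= L)%N ->
  trunc (crank_eo_gf K) = trunc (crank_eo_gf L).
Proof.
move=> leK leL; rewrite !trunc_crank_eo_gf.
by rewrite (@qpoch_stable _ _ _ K L) // (@qpochinv_stable _ _ _ K L).
Qed.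

Lemma rhs_gf_stable K L : (m <= K)%N -> (m <= L)%N ->
  trunc (rhs_gf K) = trunc (rhs_gf L).
Proof.
move=> leK leL; rewrite !trunc_rhs_gf.
by rewrite !(@qpoch_stable _ _ _ K L) // (@qpochinv_stable _ _ _ K L).
Qed.

Lemma trunc_qpoch_large d K L : (0 < d)%N -> (m <= K)%N -> (m <= L)%N ->
  trunc (qpoch 1 d d K) = poch (q ^+ d) L.+1.
Proof. by move=> d0 leK leL; rewrite (@qpoch_stable _ _ _ K L) // trunc_qpoch1. Qed.

Lemma trunc_qpochN_large K L : (m <= K)%N -> (m <= L)%N ->
  trunc (qpoch (-1) 1 1 K) = pochN q L.+1.
Proof. by move=> leK leL; rewrite (@qpoch_stable _ _ _ K L) // trunc_qpochN. Qed.

End TruncatedProducts.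

(** * Coefficients at multiples of 5 and the final comparison *)

Local Notation tq m := (trunc m ('X : {poly int})).

Lemma fcoef_stable (F : nat -> {poly int}) n K :
  (trunc n (F n) = trunc n (F K)) -> fcoef F n = (F K)`_n.
Proof. by move=> /trunc_coefP; apply. Qed.

(** A lift of [koebe] at -q^k to actual polynomials, whose coefficients can be read off. *)
Definition koebe_poly D k : {poly int} := \sum_(d < D) (- 'X^k) ^+ d *+ d.

Lemma koebe_poly_coef D k i : (0 < k)%N -> (i < D)%N ->
  (koebe_poly D k)`_i = if (k %| i)%N then (-1) ^+ (i %/ k) *+ (i %/ k) else 0.
Proof.
move=> k0 lt_i; rewrite coef_sum.
have E (d : 'I_D) : ((- 'X^k) ^+ d *+ d : {poly int})`_i =
    if i == (k * d)%N then (-1) ^+ d *+ d else 0.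
  have -> : (- 'X^k) ^+ d = ((-1) ^+ d)%:P * 'X^(k * d) :> {poly int}.
    by rewrite [LHS]exprNn -exprM polyC_exp polyCN.
  rewrite coefMn coefCM coefXn; case: eqP => _; first by rewrite mulr1.
  by rewrite mulr0 mul0rn.
under eq_bigr => d _ do rewrite E.
case: ifP => [/dvdnP [e Ei] | ndiv]; last first.
  rewrite big1 // => d _; case: eqP => // Ei.
  by rewrite Ei dvdn_mulr in ndiv.
have lt_e : (e < D)%N by nia.
rewrite (bigD1 (Ordinal lt_e)) //= big1 ?addr0 => [|d ne].
  by rewrite Ei mulnC eqxx mulKn.
case: eqP => // H; case/eqP: ne; apply: val_inj => /=.
by move: H; rewrite Ei; nia.
Qed.

(** As k is prime to 5, it divides 5 i exactly when it divides i; the quotient gains a factor 5, and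
    its parity, hence the sign, is kept. *)
Lemma koebe_poly_dilate D k i : coprime k 5 -> (5 * i < D)%N ->
  (koebe_poly D k)`_(5 * i) = 5%:R * (koebe_poly D k)`_i.
Proof.
move=> co lt_i; have k0 : (0 < k)%N by case: k co.
rewrite !koebe_poly_coef //; last by lia.
rewrite Gauss_dvdr //; case: ifP => [/dvdnP [e ->]|]; last by rewrite mulr0.
rewrite mulnA !mulnK // [RHS]mulr_natl -mulrnA mulnC.
by congr (_ *+ _); rewrite -signr_odd -[RHS]signr_odd oddM andbT.
Qed.

Definition lambert_poly D N a b : {poly int} :=
  \sum_(j < N) (koebe_poly D (5 * j + a) + koebe_poly D (5 * j + b)).

Lemma lambert_poly_dilate D N a b i : coprime a 5 -> coprime b 5 ->
  (5 * i < D)%N ->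
  (lambert_poly D N a b)`_(5 * i) = 5%:R * (lambert_poly D N a b)`_i.
Proof.
have co c j : coprime c 5 -> coprime (5 * j + c) 5.
  by rewrite /coprime [gcdn (_ + _) _]gcdnC mulnC gcdnMDl gcdnC.
move=> ca cb lt_i; rewrite !coef_sum mulr_sumr; apply: eq_bigr => j _.
by rewrite !coefD mulrDr; congr (_ + _); apply: koebe_poly_dilate => //; apply: co.
Qed.

Lemma trunc_lambert_poly m a b :
  trunc m (lambert_poly m.+1 (2 * m.+1).+2 a b) = lambert m.+1 (tq m) a b.
Proof.
have kE c j : trunc m (koebe_poly m.+1 (5 * j + c)) =
    koebe m.+1 (- tq m ^+ c * (tq m ^+ 5) ^+ j).
  rewrite rmorph_sum; apply: eq_bigr => d _.
  rewrite rmorphMn rmorphXn rmorphN rmorphXn /= -exprM mulNr -exprD.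
  by rewrite addnC.
by rewrite rmorph_sum; apply: eq_bigr => j _; rewrite rmorphD /= !kE.
Qed.

Lemma trunc_crank_lambert m K (N := (2 * m.+1).+2) : (m <= K)%N ->
  trunc m ('X * (crank_eo_gf K * (qpoch 1 5 5 K * qpoch 1 10 10 K ^+ 2))) =
  trunc m (lambert_poly m.+1 N 2 3 - lambert_poly m.+1 N 1 4).
Proof.
move=> leK; have q0 := @truncX_nil int m.
have reg2 : GRing.lreg (2%:R : int) by apply: mulfI.
have leN : (m <= N.-1)%N by rewrite /N; lia.
have I := @trunc_qpochinv m (-1) 1 1 K isT leK.
rewrite (trunc_qpochN_large leK leN) in I.
have H := crank_lambert q0 (@lreg_trunc int m 2 reg2) I.
rewrite !(rmorphM, rmorphB) /= !trunc_lambert_poly -H.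
by rewrite !(fun d d0 => @trunc_qpoch_large m d K N.-1 d0 leK leN).
Qed.

(** Extraction of the exponents 5 i + 4; the bound [size p] suffices since 5 i + 4 >= i. *)
Definition sect (p : {poly int}) : {poly int} := \poly_(i < size p) p`_(5 * i + 4).

Lemma coef_sect p i : (sect p)`_i = p`_(5 * i + 4).
Proof.
rewrite coef_poly; case: ltnP => // le_i; rewrite nth_default // (leq_trans le_i) //; lia.
Qed.

(** Multiplication by q^5 moves the index 5 i + 4 to 5 (i + 1) + 4, so after extraction it is
    multiplication by q. *)
Lemma sect_mul p d : sect (p * (d \Po 'X^5)) = sect p * d.
Proof.
elim/poly_ind: d => [|d c IH].
  by rewrite comp_poly0 !mulr0; apply/polyP => i; rewrite coef_sect !coef0.
rewrite comp_polyD comp_polyM comp_polyX comp_polyC !mulrDr (mulrA p) (mulrA (sect p)) -IH.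
apply/polyP => i; rewrite coef_sect !coefD coefMXn coefMX !coefMC !coef_sect.
case: i => [|i] //=; have -> : (5 * i.+1 + 4 - 5 = 5 * i + 4)%N by lia.
by case: ltnP => //; lia.
Qed.

Lemma qpoch_dilate c a b k K : qpoch c a b K \Po 'X^k = qpoch c (k * a) (k * b) K.
Proof.
rewrite /qpoch rmorph_prod /=; apply: eq_bigr => j _.
rewrite comp_polyB -polyC1 comp_polyC comp_polyZ comp_Xn_poly -exprM.
by rewrite mulnDr mulnA.
Qed.

(** The factor q makes coefficient k of the product the Lambert coefficient k + 1; as (5 i + 4) + 1
    = 5 (i + 1), the dilation by 5 applies. *)
Lemma crank_sect n K (e := crank_eo_gf K * (qpoch 1 5 5 K * qpoch 1 10 10 K ^+ 2)) i :
  (5 * n + 5 <= K)%N -> (i <= n)%N -> e`_(5 * i + 4) = 5%:R * e`_i.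
Proof.
move=> leK le_i; have := trunc_crank_lambert leK; rewrite -/e.
set L := _ - _ => E.
have ceq k : (k < 5 * n + 5)%N -> e`_k = L`_k.+1.
  by move=> lt_k; have /trunc_coefP/(_ k.+1) := E; rewrite coefXM /= => ->.
rewrite !ceq; try by lia.
have -> : (5 * i + 4).+1 = (5 * i.+1)%N by lia.
by rewrite /L !coefB !lambert_poly_dilate // ?mulrBr //; lia.
Qed.

Theorem theorem1p4 :
  forall n : nat, Me_minus_Mo (5 * n + 4) = fcoef rhs_gf n.
Proof.
move=> n; pose K := (5 * n + 5)%N.
rewrite /Me_minus_Mo (@fcoef_stable _ _ K); last by apply: crank_eo_gf_stable; lia.
rewrite (@fcoef_stable rhs_gf _ K); last by apply: rhs_gf_stable; lia.
rewrite -coef_sect; apply: (proj1 (trunc_coefP (A := int) n _ _)) (ltnSn n).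
(* D is f_1 f_2^2, which q -> q^5 turns into f_5 f_10^2. *)
pose D := qpoch 1 1 1 K * qpoch 1 2 2 K ^+ 2.
have DE : qpoch 1 5 5 K * qpoch 1 10 10 K ^+ 2 = D \Po 'X^5.
  by rewrite /D comp_polyM rmorphXn /= !qpoch_dilate.
have regD : GRing.lreg (trunc n D).
  rewrite rmorphM rmorphXn /= !trunc_qpoch1.
  have pn d : (0 < d)%N -> (tq n ^+ d) ^+ n.+1 = 0.
    by move=> d0; rewrite -exprM mulnC exprM truncX_nil expr0n -[(_ == _)%N]negbK -lt0n d0.
  by apply: lregM; [|apply: lregX]; apply: lreg_poch; apply: pn.
(* Multiplied by D, the left side becomes the extraction from the crank series times f_5 f_10^2, to
   which [crank_sect] applies. *)
apply: regD; rewrite -[LHS]rmorphM [D * _]mulrC -sect_mul -DE trunc_rhs_gf.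
transitivity (trunc n (5%:R * (crank_eo_gf K * (qpoch 1 5 5 K * qpoch 1 10 10 K ^+ 2)))).
  apply/trunc_coefP => i lt_i; rewrite coef_sect (@crank_sect n) //.
  by rewrite -polyC_natr coefCM.
have tr5 (a b c : {poly int}) : trunc n (5%:R * (a * (b * c ^+ 2))) =
    5%:R * (trunc n a * (trunc n b * trunc n c ^+ 2)) by rewrite !rmorphM rmorph_nat.
have trD (a b : {poly int}) : trunc n (a * b ^+ 2) = trunc n a * trunc n b ^+ 2.
  by rewrite !rmorphM.
rewrite (tr5 (crank_eo_gf K)) trunc_crank_eo_gf [trunc n D]trD.
(* The goal shows only the inverse of (-q; q), so h is given explicitly. *)
apply: (@crank_rhs _ _ _ _ (trunc n (qpoch (-1) 1 1 K))).
- by apply: trunc_qpochinv; lia.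
- by apply: trunc_qpochinv; lia.
(* With 2 (K + 1) factors, (q; q) splits exactly into K + 1 odd and K + 1 even exponents. *)
- rewrite (@qpoch_stable n 1 1 1 K (2 * K.+1).-1) //; try lia.
  have -> : (2 * K.+1).-1 = (2 * K).+1 by lia.
  rewrite !trunc_qpoch (_ : (2 * K).+2 = 2 * K.+1)%N; last by lia.
  rewrite (@prod_mod2 _ K.+1 (fun j => 1 - 1%:~R * tq n ^+ (1 + 1 * j))).
  by congr (_ * _); apply: eq_bigr => j _; congr (1 - _ * _ ^+ _); lia.
- by rewrite trunc_qpochN !trunc_qpoch1 expr1 poch_pochN.
- by rewrite trunc_qpoch1 expr1; apply: lreg_poch (@truncX_nil int n).
Qed.
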